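(* Let $\mathcal{P}$ be an ADP problem and let $\mathrm{Pol}$ be a weakly monotonic, multilinear polynomial interpretation over $\Sigma^\#$. Let $\mathcal{P}=\mathcal{P}_{\ge}\uplus\mathcal{P}_{>}$ with $\mathcal{P}_>\neq\emptyset$ such that: (1) for every $\ell\to\{p_1:r_1,\dots,p_k:r_k\}^{\mathsf{true}}\in\mathcal{P}$ we have $\mathrm{Pol}(\ell)\ge\sum_{1\le j\le k}p_j\cdot\mathrm{Pol}(\flat(r_j))$; (2) for every $\ell\to\{p_1:r_1,\dots,p_k:r_k\}^m\in\mathcal{P}$ we have $\mathrm{Pol}(\ell^\#)\ge\sum_{1\le j\le k}p_j\cdot\sum_{t\trianglelefteq_\# r_j}\mathrm{Pol}(t^\#)$; (3) for every $\ell\to\{p_1:r_1,\dots,p_k:r_k\}^m\in\mathcal{P}_>$ there is $1\le j\le k$ with $\mathrm{Pol}(\ell^\#)>\sum_{t\trianglelefteq_\# r_j}\mathrm{Pol}(t^\#)$, and if $m=\mathsf{true}$ then additionally $\mathrm{Pol}(\ell)\ge\mathrm{Pol}(\flat(r_j))$. Then $\mathcal{P}$ is iAST if and only if $\mathcal{P}_\ge\cup\flat(\mathcal{P}_>)$ is iAST (i.e., $\mathrm{Proc}_{\mathtt{RP}}(\mathcal{P})=\{\mathcal{P}_\ge\cup\flat(\mathcal{P}_>)\}$ is sound and complete).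
   Context: Fix a finite signature $\Sigma=\mathcal{D}\uplus\mathcal{C}$ (defined symbols and constructors) and a set of variables $\mathcal{V}$; all left-hand sides of ADPs have root in $\mathcal{D}$. For each $f\in\mathcal{D}$ let $f^\#$ be a fresh symbol of the same arity, $\mathcal{D}^\#=\{f^\#\mid f\in\mathcal{D}\}$, $\Sigma^\#=\Sigma\uplus\mathcal{D}^\#$; elements of $\mathcal{T}(\Sigma^\#,\mathcal{V})$ are annotated terms. $\mathrm{pos}_{\Sigma'}(t)$ is the set of positions of $t$ carrying a symbol of $\Sigma'$. $\flat(t)$ removes all annotations from $t$ (applied termwise to ADPs and sets of ADPs); $t^\#$ is $t$ with its (defined) root symbol annotated and no other annotations; $\flat_{\uparrow\pi}(t)$ removes all annotations strictly above position $\pi$. $t\trianglelefteq_\# s$ means $t=\flat(s|_\pi)$ for some $\pi\in\mathrm{pos}_{\mathcal{D}^\#}(s)$; a sum $\sum_{t\trianglelefteq_\# s}$ ranges over all such positions $\pi$. A polynomial interpretation $\mathrm{Pol}$ maps each $f\in\Sigma^\#$ of arity $n$ to a polynomial $f_{\mathrm{Pol}}\in\mathbb{N}[x_1,\dots,x_n]$ and extends homomorphically to terms, yielding $\mathrm{Pol}(t)\in\mathbb{N}[\mathcal{V}]$. It is weakly monotonic if $x\ge y$ implies $f_{\mathrm{Pol}}(\dots,x,\dots)\ge f_{\mathrm{Pol}}(\dots,y,\dots)$, and multilinear if all monomials have the form $c\cdot x_1^{e_1}\cdots x_n^{e_n}$ with $c\in\mathbb{N}$, $e_i\in\{0,1\}$.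 An inequation between polynomials holds if it is true for all instantiations of its variables by natural numbers. A finite multi-distribution on $A\neq\emptyset$ is a finite multiset of pairs $(p:a)$, $0<p\le1$, $a\in A$, with probabilities summing to 1. An ADP is $\ell\to\{p_1:r_1,\dots,p_k:r_k\}^m$ with $\ell\in\mathcal{T}(\Sigma,\mathcal{V})\setminus\mathcal{V}$, $m\in\{\mathsf{true},\mathsf{false}\}$, $\{p_1:r_1,\dots,p_k:r_k\}$ a finite multi-distribution on $\mathcal{T}(\Sigma^\#,\mathcal{V})$, $\mathcal{V}(r_j)\subseteq\mathcal{V}(\ell)$. An ADP problem is a finite set $\mathcal{P}$ of ADPs. An annotated term $t$ is a $\mathcal{P}$-normal form if no subterm of $\flat(t)$ is an instance of a left-hand side of $\mathcal{P}$; $\mathtt{ANF}_{\mathcal{P}}$ is the set of annotated terms whose proper subterms are all $\mathcal{P}$-normal forms. $s\hookrightarrow_{\mathcal{P}}\{p_1:t_1,\dots,p_k:t_k\}$ holds if there are an ADP $\ell\to\{p_1:r_1,\dots,p_k:r_k\}^m\in\mathcal{P}$, a substitution $\sigma$ and $\pi\in\mathrm{pos}_{\mathcal{D}\cup\mathcal{D}^\#}(s)$ with $\flat(s|_\pi)=\ell\sigma\in\mathtt{ANF}_{\mathcal{P}}$ such that for all $j$: (pr) $t_j=s[r_j\sigma]_\pi$ if $\pi\in\mathrm{pos}_{\mathcal{D}^\#}(s)$, $m=\mathsf{true}$; (p) $t_j=\flat_{\uparrow\pi}(s[r_j\sigma]_\pi)$ if $\pi\in\mathrm{pos}_{\mathcal{D}^\#}(s)$,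 $m=\mathsf{false}$; (r) $t_j=s[\flat(r_j)\sigma]_\pi$ if $\pi\notin\mathrm{pos}_{\mathcal{D}^\#}(s)$, $m=\mathsf{true}$; (irr) $t_j=\flat_{\uparrow\pi}(s[\flat(r_j)\sigma]_\pi)$ if $\pi\notin\mathrm{pos}_{\mathcal{D}^\#}(s)$, $m=\mathsf{false}$. A $\mathcal{P}$-chain tree (CT) is $\mathfrak{T}=(V,E,L,V_P)$: (1) $(V,E)$ a (possibly infinite) directed tree, $V\neq\emptyset$, every node with finitely many children; (2) $L$ labels each node $v$ with $(p_v,t_v)\in(0,1]\times\mathcal{T}(\Sigma^\#,\mathcal{V})$, $p_v=1$ at the root; (3) $V_P$ is a set of inner nodes, $V_R$ the remaining inner nodes; (4) if $v\in V_P$ has children $w_1,\dots,w_k$ then $t_v\hookrightarrow_{\mathcal{P}}\{\frac{p_{w_1}}{p_v}:t_{w_1},\dots,\frac{p_{w_k}}{p_v}:t_{w_k}\}$ by case (pr) or (p); (5) likewise for $v\in V_R$ by case (r) or (irr); (6) every infinite path contains infinitely many nodes of $V_P$. $|\mathfrak{T}|_{\mathtt{Leaf}}$ is the sum of $p_v$ over all leaves. $\mathcal{P}$ is iAST if $|\mathfrak{T}|_{\mathtt{Leaf}}=1$ for every $\mathcal{P}$-CT. *)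

(* Defs.v *)
(* Importing mpoly after the analysis libraries fails on a notation clash. *)
From mathcomp Require Import mpoly.
From HB Require Import structures.
From mathcomp Require Import all_boot all_order all_algebra.
From mathcomp Require Import finmap multiset.
From mathcomp Require Import all_classical all_reals.
From mathcomp Require Import ereal esum.
From Stdlib Require Import Relation_Operators.

Set Implicit Arguments.
Unset Strict Implicit.
Unset Printing Implicit Defensive.

Import Order.TTheory GRing.Theory Num.Theory.
Local Open Scope mset_scope.
Local Open Scope classical_set_scope.
Local Open Scope ring_scope.

Record signature := Signature {
  dsym : finType;
  csym : finType;
  arity : dsym + csym -> nat
}.

(* Sigma^# = Sigma + D^#: [inl f] is the symbol f, [inr d] is d^#. *)
Definition asym (S : signature) : Type := ((dsym S + csym S) + dsym S)%type.

Definition base (S : signature) (f : asym S) : dsym S + csym S :=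
  match f with inl g => g | inr d => inl d end.

Definition aarity (S : signature) (f : asym S) : nat := arity (base f).

Definition defined (S : signature) : pred (asym S) :=
  fun f => if f is inl (inl _) then true else false.

Definition annotated (S : signature) : pred (asym S) :=
  fun f => if f is inr _ then true else false.

(* T(Sigma^#, X); the subset T(Sigma, X) is the predicate [plain]. *)
Inductive term (S : signature) (X : Type) : Type :=
| Var of X
| App (f : asym S) of ('I_(aarity f) -> term S X).

Arguments Var {S X} _.
Arguments App {S X} f _.

HB.instance Definition _ (S : signature) (X : Type) := gen_eqMixin (term S X).
HB.instance Definition _ (S : signature) (X : Type) :=
  gen_choiceMixin (term S X).

Section Terms.
Context {S : signature} {X : Type}.
Local Notation term := (term S X).

Fixpoint plain (t : term) : Prop :=
  match t with
  | Var _ => True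
  | App f a => ~~ annotated f /\ forall i, plain (a i)
  end.

Fixpoint vars (t : term) : set X :=
  match t with
  | Var x => [set x]
  | App f a => [set x | exists i, vars (a i) x]
  end.

Fixpoint subst (sigma : X -> term) (t : term) : term :=
  match t with
  | Var x => sigma x
  | App f a => App f (fun i => subst sigma (a i))
  end.

(* Typechecks because f and [inl (base f)] have convertible arities. *)
Fixpoint flat (t : term) : term :=
  match t with
  | Var x => Var x
  | App f a => App (inl (base f)) (fun i => flat (a i))
  end.

(* t^#; meaningful only if the root of t is in D or D^#. *)
Definition sharp (t : term) : term :=
  match t with
  | Var x => Var x
  | App f a =>
      match base f as g return ('I_(arity g) -> term) -> term with
      | inl d => fun b => App (inr d) b
      | inr c => fun b => App (inl (inr c)) b
      end (fun i => flat (a i))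
  end.

Fixpoint positions (t : term) : seq (seq nat) :=
  match t with
  | Var _ => [:: [::]]
  | App f a =>
      [::] :: flatten [seq [seq nat_of_ord i :: p | p <- positions (a i)]
                      | i <- enum 'I_(aarity f)]
  end.

(* The values of [subterm], [replace] and [flat_above] outside of
   [positions t] are junk. *)
Fixpoint subterm (t : term) (p : seq nat) {struct p} : term :=
  match p, t with
  | i :: q, App f a =>
      if (insub i : option 'I_(aarity f)) is Some j then subterm (a j) q else t
  | _, _ => t
  end.

Fixpoint replace (t : term) (p : seq nat) (u : term) {struct p} : term :=
  match p, t with
  | [::], _ => u
  | i :: q, App f a =>
      App f (fun j => if (j : nat) == i then replace (a j) q u else a j)
  | _ :: _, Var _ => t
  end.

Fixpoint flat_above (p : seq nat) (t : term) {struct p} : term :=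
  match p, t with
  | i :: q, App f a =>
      App (inl (base f))
          (fun j => if (j : nat) == i then flat_above q (a j) else a j)
  | _, _ => t
  end.

Definition root_in (A : pred (asym S)) (t : term) : bool :=
  if t is App f _ then A f else false.

Definition pos_in (A : pred (asym S)) (t : term) : seq (seq nat) :=
  [seq p <- positions t | root_in A (subterm t p)].

End Terms.

(* N[x_1, ..., x_n] is the set of integer polynomials with coefficients >= 0. *)
Record polint (S : signature) := PolInt {
  sympol : forall f : asym S, {mpoly int[aarity f]};
  sympol_ge0 : forall f m, 0 <= (sympol f)@_m
}.

Section Interpretation.
Context {S : signature} (Pol : polint S).

Definition sym_eval (f : asym S) (v : 'I_(aarity f) -> int) : int :=
  (sympol Pol f).@[v].

Definition weakly_monotonic : Prop :=
  forall (f : asym S) (v w : 'I_(aarity f) -> nat) (i : 'I_(aarity f)),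
    (forall j, j != i -> v j = w j) -> (w i <= v i)%N ->
    sym_eval (fun j => (w j)%:Z) <= sym_eval (fun j => (v j)%:Z).

Definition multilinear : Prop :=
  forall (f : asym S) m, m \in msupp (sympol Pol f) ->
    forall i : 'I_(aarity f), (m i <= 1)%N.

Context {X : Type}.

(* The value of the polynomial Pol(t) in N[X] at the instantiation alpha. *)
Fixpoint pol (alpha : X -> nat) (t : term S X) : int :=
  match t with
  | Var x => (alpha x)%:Z
  | App f a => sym_eval (fun i => pol alpha (a i))
  end.

Definition pol_annot (alpha : X -> nat) (s : term S X) : int :=
  \sum_(p <- pos_in (@annotated S) s) pol alpha (sharp (flat (subterm s p))).

End Interpretation.

Record adp (S : signature) (X : Type) (R : realType) := ADP {
  lhs : term S X;
  rhs : {mset R * term S X};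
  flag : bool
}.

Section ADPProblems.
Context {S : signature} {X : Type} {R : realType}.
Local Notation term := (term S X).
Local Notation adp := (adp S X R).

Definition mset_map (T U : choiceType) (f : T -> U) (d : {mset T}) : {mset U} :=
  seq_mset [seq f x | x <- d].

Definition is_multidist (T : choiceType) (d : {mset R * T}) : Prop :=
  (forall x, x \in d -> 0 < x.1 <= 1) /\ \sum_(x <- d) x.1 = 1.

Definition is_adp (a : adp) : Prop :=
  [/\ plain (lhs a),
      root_in (@defined S) (lhs a),
      is_multidist (rhs a) &
      forall x, x \in rhs a -> vars x.2 `<=` vars (lhs a)].

Definition adp_problem (P : set adp) : Prop :=
  finite_set P /\ forall a, P a -> is_adp a.

Definition flat_adp (a : adp) : adp :=
  ADP (flat (lhs a)) (mset_map (fun x => (x.1, flat x.2)) (rhs a)) (flag a).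

Definition normal_form (P : set adp) (t : term) : Prop :=
  forall p, p \in positions (flat t) ->
    forall a sigma, P a -> subterm (flat t) p <> subst sigma (lhs a).

Definition ANF (P : set adp) (t : term) : Prop :=
  forall p, p \in positions t -> p <> [::] -> normal_form P (subterm t p).

(* [ann] tells whether the redex position p of s is annotated, [m] is the flag
   of the ADP; the four cases are (pr), (p), (r), (irr). *)
Definition contract (ann m : bool) (s : term) (p : seq nat)
    (sigma : X -> term) (r : term) : term :=
  match ann, m with
  | true, true => replace s p (subst sigma r)
  | true, false => flat_above p (replace s p (subst sigma r))
  | false, true => replace s p (subst sigma (flat r))
  | false, false => flat_above p (replace s p (subst sigma (flat r)))
  end.

(* [step P true] is rewriting by (pr) or (p), [step P false] by (r) or (irr). *)
Definition step (P : set adp) (ann : bool) (s : term)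
    (d : {mset R * term}) : Prop :=
  exists (a : adp) (sigma : X -> term) (p : seq nat),
    [/\ P a,
        p \in pos_in (predU (@defined S) (@annotated S)) s,
        (p \in pos_in (@annotated S) s) = ann,
        flat (subterm s p) = subst sigma (lhs a) /\
        ANF P (subst sigma (lhs a)) &
        d = mset_map (fun x => (x.1, contract ann (flag a) s p sigma x.2))
                     (rhs a)].

(* [edge v] is the set of children of v; [nodesP] is V_P. *)
Record ltree := LTree {
  carrier : choiceType;
  nodes : set carrier;
  edge : carrier -> set carrier;
  prob : carrier -> R;
  label : carrier -> term;
  nodesP : set carrier
}.

Definition inner (T : ltree) : set (carrier T) :=
  [set v | nodes v /\ edge v !=set0].

Definition leaves (T : ltree) : set (carrier T) :=
  [set v | nodes v /\ edge v = set0].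

Definition is_root (T : ltree) (r : carrier T) : Prop :=
  [/\ nodes r,
      forall v, ~ edge v r &
      forall v, nodes v -> clos_refl_trans (carrier T) (@edge T) r v].

Definition is_tree (T : ltree) : Prop :=
  [/\ forall v w, @edge T v w -> nodes v /\ nodes w,
      forall u v w, @edge T u w -> edge v w -> u = v &
      exists r : carrier T, is_root r].

Definition children_dist (T : ltree) (v : carrier T) : {mset R * term} :=
  seq_mset [seq (prob w / prob v, label w) | w <- fset_set (edge v)].

Record chain_tree (P : set adp) (T : ltree) : Prop := ChainTree {
  ct_tree : is_tree T;
  ct_finite : forall v : carrier T, nodes v -> finite_set (edge v);
  ct_prob : forall v : carrier T, nodes v -> 0 < prob v <= 1;
  ct_root : forall r : carrier T, is_root r -> prob r = 1;
  ct_nodesP : @nodesP T `<=` @inner T;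
  ct_stepP : forall v : carrier T, nodesP v ->
    step P true (label v) (children_dist v);
  ct_stepR : forall v : carrier T, inner v -> ~ nodesP v ->
    step P false (label v) (children_dist v);
  ct_infinite : forall u : nat -> carrier T,
    (forall n, edge (u n) (u n.+1)) ->
    forall n, exists2 m, (n <= m)%N & nodesP (u m)
}.

Definition leaf_mass (T : ltree) : \bar R :=
  \esum_(v in @leaves T) (prob v)%:E.

Definition iAST (P : set adp) : Prop :=
  forall T : ltree, chain_tree P T -> leaf_mass T = 1%:E.

End ADPProblems.

(* Main.v *)
(* Completeness: a chain tree of the flattened problem becomes one of P by
   keeping its shape and relabelling top-down with more annotated terms; a step
   at an unannotated position may turn into an annotated one, which only adds
   nodes to V_P.

   Soundness: let V(t) be the sum of Pol(s^#) over the annotated subterms s of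
   t. Multilinearity makes contexts affine, so V is a supermartingale along
   every chain tree, and at every node that uses an annotated step of Pgt it
   drops by at least 1 with a probability bounded from below. The bounded,
   strictly concave transform V / (1 + V) then loses a fixed amount at each such
   node with V < N, so that the expected number of visits to them is finite,
   while V ever reaches N with probability at most V(root) / N. Far down the
   tree almost all mass therefore avoids Pgt, and the subtrees cut at the Pgt
   nodes are chain trees of the flattened problem, which terminate almost
   surely. *)
From mathcomp Require Import mpoly.
From mathcomp Require Import all_boot all_order all_algebra.
From mathcomp Require Import finmap multiset.
From mathcomp Require Import all_classical all_reals.
From mathcomp Require Import ereal normedtype sequences esum.
From mathcomp Require Import ring lra.
From Stdlib Require Import Relation_Operators.
(* Imported last: constructive_ereal also defines a constant [contract]. *)
Require Import Defs.
Set Implicit Arguments.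
Unset Strict Implicit.
Unset Printing Implicit Defensive.
Import Order.TTheory GRing.Theory Num.Theory.
Local Open Scope mset_scope.
Local Open Scope classical_set_scope.
Local Open Scope ring_scope.

Section TermFacts.
Context {S : signature} {X : Type}.
Implicit Types (t s u r : term S X) (p : seq nat) (sigma : X -> term S X).

Lemma eq_App (f : asym S) (a b : 'I_(aarity f) -> term S X) :
  a =1 b -> App f a = App f b.
Proof. by move=> /funext ->. Qed.

Lemma flat_flat t : flat (flat t) = flat t.
Proof. by elim: t => //= f a IH; apply: eq_App. Qed.

Lemma plain_flat t : plain (flat t).
Proof. by elim: t. Qed.

Lemma flat_plain t : plain t -> flat t = t.
Proof.
elim: t => //= -[g|d] a IH [// _ pa].
by apply: eq_App => i; apply: IH.
Qed.

Lemma plain_subst_vars sigma t x :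
  plain (subst sigma t) -> vars t x -> plain (sigma x).
Proof.
elim: t => [y /= + ->//|f a IH /= [_ pa] [i]]; exact: IH.
Qed.

Lemma flat_subst sigma t :
  flat (subst sigma t) = subst (flat \o sigma) (flat t).
Proof. by elim: t => //= f a IH; apply: eq_App. Qed.

Lemma vars_flat t : vars (flat t) = vars t.
Proof.
elim: t => //= f a IH; apply/seteqP; split=> x [i]; exists i.
- by rewrite -IH.
- by rewrite IH.
Qed.

Lemma sharp_subst (A : pred (asym S)) sigma t : root_in A t ->
  sharp (subst sigma t) = subst (flat \o sigma) (sharp t).
Proof.
by case: t => // -[[d|c]|d] a _ /=; apply: eq_App => i; rewrite flat_subst.
Qed.

Lemma mem_positions_cons (f : asym S) (a : 'I_(aarity f) -> term S X) i q :
  i :: q \in positions (App f a) ->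
  exists2 j : 'I_(aarity f), i = j & q \in positions (a j).
Proof.
rewrite inE /= => /flattenP[s /mapP[j _ ->]] /mapP[q' q'a [-> ->]].
by exists j.
Qed.

Lemma subterm_cons (f : asym S) (a : 'I_(aarity f) -> term S X)
    (j : 'I_(aarity f)) q :
  subterm (App f a) ((j : nat) :: q) = subterm (a j) q.
Proof. by rewrite /= valK. Qed.

Lemma replace_subterm t p :
  p \in positions t -> replace t p (subterm t p) = t.
Proof.
elim: p t => [|i q IH] [y|f a]; rewrite ?inE // => /mem_positions_cons.
move=> [j -> qa]; rewrite subterm_cons /=; apply: eq_App => k.
by case: eqP => // /val_inj ->; rewrite IH.
Qed.

Lemma pos_in_annotated_App (f : asym S) (a : 'I_(aarity f) -> term S X) :
  pos_in (@annotated S) (App f a) =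
  (if annotated f then [:: [::]] else [::]) ++
  flatten [seq [seq nat_of_ord i :: p | p <- pos_in (@annotated S) (a i)]
          | i <- enum 'I_(aarity f)].
Proof.
rewrite {1}/pos_in /= filter_flatten -map_comp /=.
case: annotated => /=; [congr (_ :: flatten _)|congr flatten];
  apply: eq_map => i /=; rewrite filter_map; congr map;
  by apply: eq_filter => p; rewrite /= valK.
Qed.

End TermFacts.

Section Evaluation.
Context {S : signature} (Pol : polint S) {X : Type}.
Implicit Types (t s u r : term S X) (p : seq nat) (sigma : X -> term S X).
Implicit Types (alpha : X -> nat).

Fixpoint annot_val alpha t : int :=
  match t with
  | Var _ => 0
  | App f a =>
      (if annotated f then sym_eval Pol (fun i => pol Pol alpha (flat (a i)))
       else 0) + \sum_i annot_val alpha (a i)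
  end.

Lemma pol_annotE alpha t : pol_annot Pol alpha t = annot_val alpha t.
Proof.
elim: t => [x|f a IH]; rewrite /pol_annot; first by rewrite /= big_nil.
rewrite pos_in_annotated_App big_cat big_flatten /= big_map.
congr (_ + _).
  case: f a {IH} => [g|d] a /=; first by rewrite big_nil.
  rewrite big_seq1 /=; congr sym_eval; apply/funext => i.
  by rewrite flat_flat.
rewrite big_enum /=; apply: eq_bigr => i _; rewrite big_map -IH.
by apply: eq_bigr => p _; rewrite subterm_cons.
Qed.

Lemma sym_eval_ge0 f (v : 'I_(aarity f) -> int) :
  (forall i, 0 <= v i) -> 0 <= sym_eval Pol v.
Proof.
move=> v0; rewrite /sym_eval mevalE; apply: sumr_ge0 => m _.
apply: mulr_ge0; first exact: sympol_ge0.
by apply: prodr_ge0 => i _; apply: exprn_ge0.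
Qed.

Lemma pol_ge0 alpha t : 0 <= pol Pol alpha t.
Proof. by elim: t => //= f a IH; apply: sym_eval_ge0. Qed.

Lemma annot_val_ge0 alpha t : 0 <= annot_val alpha t.
Proof.
elim: t => //= f a IH; apply: addr_ge0; last exact: sumr_ge0.
by case: ifP => // _; apply: sym_eval_ge0 => i; apply: pol_ge0.
Qed.

Lemma annot_val_plain alpha t : plain t -> annot_val alpha t = 0.
Proof.
elim: t => //= f a IH [/negPf -> pa]; rewrite add0r big1 // => i _.
exact: IH.
Qed.

Lemma sharp_le_annot_val alpha t : root_in (@annotated S) t ->
  pol Pol alpha (sharp (flat t)) <= annot_val alpha t.
Proof.
case: t => [//|[//|d] a _] /=.
under eq_fun do rewrite flat_flat.
by rewrite lerDl; apply: sumr_ge0 => i _; apply: annot_val_ge0.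
Qed.

Lemma pol_subst alpha sigma t :
  pol Pol alpha (subst sigma t) =
  pol Pol (fun x => `|pol Pol alpha (sigma x)|%N) t.
Proof.
elim: t => [x|f a IH] /=; last by congr sym_eval; apply/funext.
by rewrite abszE ger0_norm // pol_ge0.
Qed.

Lemma annot_val_subst alpha sigma t :
  (forall x, vars t x -> plain (sigma x)) ->
  annot_val alpha (subst sigma t) =
  annot_val (fun x => `|pol Pol alpha (flat (sigma x))|%N) t.
Proof.
elim: t => [x /(_ x erefl) /annot_val_plain -> //|f a IH psigma] /=.
congr (_ + _); last first.
  by apply: eq_bigr => i _; apply: IH => x xa; apply: psigma; exists i.
case: ifP => // _; congr sym_eval; apply/funext => i.
by rewrite flat_subst pol_subst.
Qed.

Hypothesis Pol_multilinear : multilinear Pol.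

Lemma sym_eval_affine f (v : 'I_(aarity f) -> int) (i : 'I_(aarity f)) :
  (forall j, 0 <= v j) ->
  exists A B : int, [/\ 0 <= A, 0 <= B & forall w : 'I_(aarity f) -> int,
    (forall j, j != i -> w j = v j) -> sym_eval Pol w = A * w i + B].
Proof.
move=> v0; rewrite /sym_eval.
pose M := msupp (sympol Pol f).
pose c m := (sympol Pol f)@_m *
  \prod_(j | j != i) v j ^+ (m : 'X_{1..aarity f}) j.
have c0 m : 0 <= c m.
  apply: mulr_ge0; first exact: sympol_ge0.
  by apply: prodr_ge0 => j _; apply: exprn_ge0.
exists (\sum_(m <- M | m i == 1%N) c m), (\sum_(m <- M | m i != 1%N) c m).
split; [exact: sumr_ge0 | exact: sumr_ge0 | move=> w wv].
rewrite mevalE (bigID (fun m : 'X_{1..aarity f} => m i == 1%N)) /=.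
congr (_ + _); first rewrite mulr_suml.
  apply: eq_bigr => m /eqP mi; rewrite (bigD1 i) //= mi expr1 /c.
  rewrite -mulrA; congr (_ * _); rewrite mulrC; congr (_ * _).
  by apply: eq_bigr => j ji; rewrite wv.
rewrite big_seq_cond [RHS]big_seq_cond.
apply: eq_bigr => m /andP[mM mi]; rewrite (bigD1 i) //=.
have -> : m i = 0%N by have := Pol_multilinear mM i; case: (m i) mi => [|[]].
rewrite expr0 mul1r; congr (_ * _).
by apply: eq_bigr => j ji; rewrite wv.
Qed.

Lemma pol_replace_affine alpha s p : p \in positions s ->
  exists A B : int, [/\ 0 <= A, 0 <= B & forall u,
    pol Pol alpha (flat (replace s p u)) = A * pol Pol alpha (flat u) + B].
Proof.
elim: p s => [|i q IH] s.
  by exists 1, 0; split=> // u /=; rewrite mul1r addr0.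
case: s => [x|f a]; rewrite ?inE // => /mem_positions_cons[j -> /IH].
move=> [A [B [A0 B0 AB]]].
have [C [D [C0 D0 CD]]] := sym_eval_affine
  (f := inl (base f)) j (fun k => pol_ge0 alpha (flat (a k))).
exists (C * A), (C * B + D); split; first exact: mulr_ge0.
  by rewrite addr_ge0 // mulr_ge0.
move=> u /=; rewrite CD => [|k kj]; last first.
  by rewrite (negPf kj : _ == _ :> nat = _).
by rewrite eqxx AB mulrDr mulrA addrA.
Qed.

Lemma annot_val_replace alpha s p : p \in positions s ->
  exists A B C : int, [/\ 0 <= A, 0 <= B, C <= B & forall u,
    annot_val alpha (replace s p u) =
      annot_val alpha u + A * pol Pol alpha (flat u) + B /\
    annot_val alpha (flat_above p (replace s p u)) = annot_val alpha u + C].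
Proof.
elim: p s => [|i q IH] s.
  by exists 0, 0, 0; split=> // u /=; rewrite mul0r !addr0.
case: s => [x|f a]; rewrite ?inE // => /mem_positions_cons[j -> qa].
have [A [B [C [A0 B0 CB AB]]]] := IH _ qa.
have [A' [B' [A'0 B'0 AB']]] := pol_replace_affine alpha qa.
have [D [E [D0 E0 DE]]] := sym_eval_affine
  (f := f) j (fun k => pol_ge0 alpha (flat (a k))).
pose rest : int := \sum_(k | k != j) annot_val alpha (a k).
have rest0 : 0 <= rest by apply: sumr_ge0 => k _; apply: annot_val_ge0.
exists (A + if annotated f then D * A' else 0),
  (B + rest + if annotated f then D * B' + E else 0), (C + rest).
split.
- by rewrite addr_ge0 //; case: ifP => // _; rewrite mulr_ge0.
- rewrite !addr_ge0 //; case: ifP => // _.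
  by rewrite addr_ge0 // mulr_ge0.
- apply: ler_wpDr; last by rewrite lerD2r.
  by case: ifP => // _; rewrite addr_ge0 // mulr_ge0.
move=> u; have [ABu Cu] := AB u; split=> /=.
  rewrite (bigD1 j) //= eqxx ABu.
  rewrite (eq_bigr (fun k => annot_val alpha (a k))); last first.
    by move=> k kj; rewrite (negPf kj : _ == _ :> nat = _).
  rewrite -/rest; case: ifP => _; last by rewrite add0r !addr0 !addrA.
  rewrite DE => [|k kj]; last by rewrite (negPf kj : _ == _ :> nat = _).
  rewrite eqxx AB'; lra.
rewrite add0r (bigD1 j) //= eqxx Cu.
rewrite (eq_bigr (fun k => annot_val alpha (a k))); last first.
  by move=> k kj; rewrite (negPf kj : _ == _ :> nat = _).
by rewrite addrA.
Qed.

End Evaluation.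

Section Multisets.

Lemma perm_mset_map (T U : choiceType) (f : T -> U) (d : {mset T}) (s : seq U) :
  seq_mset s = mset_map f d -> perm_eq s [seq f x | x <- d].
Proof. by move/eq_seq_msetP. Qed.

Lemma mset_map_comp (T U V : choiceType) (f : U -> V) (g : T -> U)
    (d : {mset T}) : mset_map f (mset_map g d) = mset_map (f \o g) d.
Proof.
apply/eq_seq_msetP; rewrite (map_comp f g); apply: perm_map.
exact: perm_eq_seq_mset.
Qed.

Lemma perm_map_lift (T1 T2 U : eqType) (phi : T1 -> U) (psi : T2 -> U)
    (y0 : T2) (s1 : seq T1) (s2 : seq T2) :
  uniq s1 -> perm_eq (map phi s1) (map psi s2) ->
  exists g : T1 -> T2,
    perm_eq (map g s1) s2 /\ {in s1, forall x, phi x = psi (g x)}.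
Proof.
elim: s1 s2 => [|x s1 IH] s2 /=.
  move=> _ /perm_size /esym /eqP; rewrite size_map size_eq0 => /eqP ->.
  by exists (fun=> y0).
move=> /andP[xs1 us1] ps; have /mapP[y ys2 xy] : phi x \in map psi s2.
  by rewrite -(perm_mem ps) mem_head.
have /IH : uniq s1 by [].
move=> /(_ (rem y s2)) [|g [pg gE]].
  have /(perm_map psi) /= py := perm_to_rem ys2.
  by rewrite -(perm_cons (phi x)) (perm_trans ps) // xy.
exists [eta g with x |-> y]; split.
  rewrite /= eqxx perm_sym (perm_trans (perm_to_rem ys2)) // perm_cons.
  rewrite perm_sym (_ : map _ s1 = map g s1) //.
  apply/eq_in_map => z zs1; rewrite /=; case: eqP => // zx.
  by rewrite zx (negPf xs1) in zs1.
move=> z; rewrite inE => /orP[/eqP ->|zs1] /=; first by rewrite eqxx.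
by case: eqP => [->//|_]; apply: gE.
Qed.

End Multisets.

Section MoreAnnotated.
Context {S : signature} {X : Type}.
Implicit Types (t s u r : term S X) (p : seq nat) (sigma : X -> term S X).

Inductive more_annot : term S X -> term S X -> Prop :=
| MoreVar x : more_annot (Var x) (Var x)
| MoreSame f a b : (forall i, more_annot (a i) (b i)) ->
    more_annot (App f a) (App f b)
| MoreAdd d a b : (forall i, more_annot (a i) (b i)) ->
    more_annot (App (inl (inl d)) a) (App (inr d) b).

Lemma more_annot_refl t : more_annot t t.
Proof. by elim: t => [x|f a IH]; constructor. Qed.

Lemma more_annot_flat t t' : more_annot t t' -> flat t = flat t'.
Proof. by elim=> //= *; apply: eq_App. Qed.

Lemma more_annot_flatl t t' : more_annot t t' -> more_annot (flat t) t'.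
Proof.
elim=> {t t'} [x|[[d|c]|d] a b _ IH|d a b _ IH] /=; by constructor.
Qed.

Lemma more_annot_subst sigma t t' :
  more_annot t t' -> more_annot (subst sigma t) (subst sigma t').
Proof.
by elim=> {t t'} [x|f a b _ IH|d a b _ IH] /=;
  [exact: more_annot_refl|constructor|constructor].
Qed.

Lemma more_annot_root (A : pred (asym S)) t t' :
  (forall d, A (inl (inl d)) -> A (inr d)) ->
  more_annot t t' -> root_in A t -> root_in A t'.
Proof. by move=> Ad; case=> //= d *; apply: Ad. Qed.

Lemma more_annot_positions t t' :
  more_annot t t' -> positions t = positions t'.
Proof.
elim=> {t t'} [x|f a b _ IH|d a b _ IH] //=; congr (_ :: flatten _);
  by apply: eq_map => i; rewrite IH.
Qed.

Lemma more_annot_subterm p t t' :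
  more_annot t t' -> more_annot (subterm t p) (subterm t' p).
Proof.
move=> tt'; elim: tt' p => {t t'} [x|f a b ab IH|d a b ab IH] [|i q] /=;
  try by constructor.
- by case: insub => [j|]; [exact: IH|constructor].
- by rewrite /aarity /=; case: insub => [j|]; [exact: IH|constructor].
Qed.

Lemma more_annot_replace p t t' u u' :
  more_annot t t' -> more_annot u u' ->
  more_annot (replace t p u) (replace t' p u').
Proof.
move=> tt'; elim: tt' p => {t t'} [x|f a b ab IH|d a b ab IH] [|i q] //= uu';
  by constructor=> // k; case: eqP => // _; apply: IH.
Qed.

Lemma more_annot_flat_above p t t' :
  more_annot t t' -> more_annot (flat_above p t) (flat_above p t').
Proof.
move=> tt'; elim: tt' p => {t t'} [x|f a b ab IH|d a b ab IH] [|i q] //=;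
  by constructor=> // k; case: eqP => // _; apply: IH.
Qed.

Lemma more_annot_contract (ann ann' m : bool) s s' p sigma r r' :
  more_annot s s' -> more_annot r r' -> (ann -> ann') ->
  more_annot (contract ann m s p sigma r) (contract ann' m s' p sigma r').
Proof.
move=> ss' rr'; rewrite /contract.
have frr' := more_annot_flat rr'.
have {}rr' := more_annot_subst sigma rr'.
have frr := more_annot_refl (subst sigma (flat r')).
have fr' := more_annot_subst sigma (more_annot_flatl (more_annot_refl r')).
by case: ann ann' m => -[] [] // ann; try (by have := ann isT); rewrite ?frr';
  try apply: more_annot_flat_above; exact: more_annot_replace.
Qed.

End MoreAnnotated.

Section Steps.
Context {S : signature} {X : Type} {R : realType}.
Implicit Types (t s u r : term S X) (p : seq nat) (sigma : X -> term S X).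
Implicit Types (P Q Pge Pgt : set (adp S X R)) (a : adp S X R).

Lemma mem_pos_in (A : pred (asym S)) t p :
  (p \in pos_in A t) = root_in A (subterm t p) && (p \in positions t).
Proof. by rewrite mem_filter. Qed.

Lemma ANF_lhs P Q t :
  (forall a, P a -> exists2 b, Q b & lhs b = lhs a) -> ANF Q t -> ANF P t.
Proof.
move=> PQ nf p pt p0 q qt a sigma /PQ[b Qb <-].
exact: (nf p pt p0 q qt b sigma).
Qed.

Lemma flat_adp_lhs a : is_adp a -> lhs (flat_adp a) = lhs a.
Proof. by move=> [/flat_plain]. Qed.

Section FlattenPgt.
Variables (P Pge Pgt : set (adp S X R)).
Hypotheses (P_adp : forall a, P a -> is_adp a) (PE : P = Pge `|` Pgt).
Local Notation P' := (Pge `|` [set flat_adp a | a in Pgt]).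

Lemma ANF_flatten t : ANF P t <-> ANF P' t.
Proof.
split; apply: ANF_lhs => a; rewrite PE.
- move=> [ge|[b gt <-]]; first by exists a => //; left.
  exists b; first by right.
  by rewrite flat_adp_lhs //; apply: P_adp; rewrite PE; right.
- move=> [ge|gt]; first by exists a => //; left.
  exists (flat_adp a); first by right; exists a.
  by rewrite flat_adp_lhs //; apply: P_adp; rewrite PE; right.
Qed.

Lemma step_unannotated_flatten s d : step P false s d -> step P' false s d.
Proof.
move=> [a [sigma [p [Pa ps ann [fs nf] ->]]]].
have [ge|gt] : (Pge `|` Pgt) a by rewrite -PE.
  by exists a, sigma, p; split=> //; [left|split=> //; apply/ANF_flatten].
have la := flat_adp_lhs (P_adp Pa).
exists (flat_adp a), sigma, p; split=> //; first by right; exists a.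
  by rewrite la; split=> //; apply/ANF_flatten.
rewrite mset_map_comp; congr mset_map; apply/funext => x /=.
by rewrite flat_flat.
Qed.

Lemma step_ge_flatten ann s d :
  step P ann s d ->
  (exists a sigma p, [/\ Pgt a, p \in positions s,
     root_in (@annotated S) (subterm s p) = ann,
     flat (subterm s p) = subst sigma (lhs a) &
     d = mset_map (fun x => (x.1, contract ann (flag a) s p sigma x.2))
                  (rhs a)]) \/
  step P' ann s d.
Proof.
move=> [a [sigma [p [Pa ps annE [fs nf] ->]]]].
move: ps; rewrite mem_pos_in => /andP[rp ps].
have [ge|gt] : (Pge `|` Pgt) a by rewrite -PE.
  right; exists a, sigma, p; split=> //; [by left|by rewrite mem_pos_in rp|].
  by split=> //; apply/ANF_flatten.
left; exists a, sigma, p; split=> //.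
by rewrite -annE mem_pos_in ps andbT.
Qed.

Lemma flatten_adp_origin a' : P' a' ->
  exists (a : adp S X R) (h : term S X -> term S X),
    [/\ P a, lhs a' = lhs a, flag a' = flag a, forall r, more_annot (h r) r &
        perm_eq (rhs a') [seq (x.1, h x.2) | x <- rhs a]].
Proof.
rewrite PE => -[ge|[a gt <-]].
  exists a', id; split=> //; [by left|exact: more_annot_refl|].
  by rewrite (eq_map (g := id)) ?map_id // => -[].
exists a, flat; split=> //; first by right.
- by apply: flat_adp_lhs; apply: P_adp; rewrite PE; right.
- by move=> r; apply/more_annot_flatl/more_annot_refl.
- exact: perm_eq_seq_mset.
Qed.

Lemma step_more_annot (K : choiceType) (q : K -> R) (lab : K -> term S X)
    (cs : seq K) ann s s' :
  uniq cs -> step P' ann s (seq_mset [seq (q w, lab w) | w <- cs]) ->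
  more_annot s s' ->
  exists g : K -> term S X, {in cs, forall w, more_annot (lab w) (g w)} /\
    exists2 ann' : bool, ann -> ann' &
      step P ann' s' (seq_mset [seq (q w, g w) | w <- cs]).
Proof.
move=> ucs [a' [sigma [p [P'a ps annE [fs nf] /perm_mset_map dE]]]] ss'.
have [a [h [Pa la fa hr ra]]] := flatten_adp_origin P'a.
move: ps annE; rewrite !mem_pos_in => /andP[rp ps]; rewrite ps andbT => annE.
have ps' : p \in positions s' by rewrite -(more_annot_positions ss').
have sub := more_annot_subterm p ss'.
pose ann' := root_in (@annotated S) (subterm s' p).
have annI : ann -> ann'.
  by rewrite -annE; apply: more_annot_root.
have := perm_trans dE (perm_map _ ra); rewrite -map_comp.
move=> /(perm_map_lift (0, s) ucs)[g [pg gE]].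
exists (fun w => contract ann' (flag a) s' p sigma (g w).2); split.
  move=> w /gE /= [_ ->]; rewrite -fa.
  exact: more_annot_contract.
exists ann' => //; exists a, sigma, p; split=> //.
- rewrite mem_pos_in ps' andbT.
  by apply: more_annot_root rp => // d; rewrite /= orbT.
- by rewrite mem_pos_in ps' andbT.
- rewrite -la -fs (more_annot_flat sub); split=> //.
  by rewrite -(more_annot_flat sub) fs; apply/ANF_flatten.
apply/eq_seq_msetP.
have -> : [seq (q w, contract ann' (flag a) s' p sigma (g w).2) | w <- cs] =
    [seq (x.1, contract ann' (flag a) s' p sigma x.2) | x <- map g cs].
  by rewrite -map_comp; apply/eq_in_map => w /gE /= [->].
exact: perm_map.
Qed.

End FlattenPgt.

Section Values.
Variables (Pol : polint S) (alpha : X -> nat).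
Hypothesis Pol_multilinear : multilinear Pol.

Lemma annot_val_contract (ann m : bool) s p sigma l :
  plain l -> root_in (@defined S) l -> p \in positions s ->
  root_in (@annotated S) (subterm s p) = ann ->
  flat (subterm s p) = subst sigma l ->
  exists (beta : X -> nat) (A B : int), [/\ 0 <= A,
    (if ann then pol Pol beta (sharp l) else 0) +
      (if m then A * pol Pol beta l else 0) + B <= annot_val Pol alpha s &
    forall r, vars r `<=` vars l ->
      annot_val Pol alpha (contract ann m s p sigma r) =
      (if ann then annot_val Pol beta r else 0) +
        (if m then A * pol Pol beta (flat r) else 0) + B].
Proof.
move=> pl dl ps annE fs.
have [A [B [C [A0 B0 CB AB]]]] := annot_val_replace Pol_multilinear alpha ps.
pose beta x := `|pol Pol alpha (flat (sigma x))|%N.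
exists beta, A, (if m then B else C).
have subE : pol Pol alpha (flat (subterm s p)) = pol Pol beta l.
  by rewrite -flat_flat fs flat_subst pol_subst (flat_plain pl).
have annS : (if ann then pol Pol beta (sharp l) else 0) <=
    annot_val Pol alpha (subterm s p).
  case: ifP annE => [_ rp|*]; last exact: annot_val_ge0.
  apply: le_trans (sharp_le_annot_val Pol alpha rp).
  by rewrite fs (sharp_subst sigma dl) pol_subst.
have psig x : vars l x -> plain (sigma x).
  by apply: plain_subst_vars; rewrite -fs; apply: plain_flat.
split=> //.
  rewrite -[s in leRHS](replace_subterm ps) (AB _).1 subE.
  case: m; first by rewrite !lerD2r.
  rewrite addr0; apply: lerD => //; apply: ler_wpDr => //.
  by rewrite mulr_ge0 // pol_ge0.
move=> r rl.
have psr x : vars r x -> plain (sigma x) by move/rl/psig.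
have av0 : annot_val Pol alpha (subst sigma (flat r)) = 0.
  rewrite annot_val_subst ?annot_val_plain ?vars_flat //; exact: plain_flat.
have fE : pol Pol alpha (flat (subst sigma r)) = pol Pol beta (flat r).
  by rewrite flat_subst pol_subst.
have fE' : pol Pol alpha (flat (subst sigma (flat r))) = pol Pol beta (flat r).
  by rewrite flat_subst flat_flat pol_subst.
by case: ann m {annE annS} => -[] /=;
  rewrite ?(AB _).1 ?(AB _).2 ?av0 ?annot_val_subst ?fE ?fE' ?addr0.
Qed.

Lemma contract_annot_val_average ann s p sigma a :
  is_adp a ->
  (flag a = true -> forall beta : X -> nat,
     \sum_(x <- rhs a) x.1 * (pol Pol beta (flat x.2))%:~R
       <= (pol Pol beta (lhs a))%:~R :> R) ->
  (forall beta : X -> nat,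
     \sum_(x <- rhs a) x.1 * (pol_annot Pol beta x.2)%:~R
       <= (pol Pol beta (sharp (lhs a)))%:~R :> R) ->
  p \in positions s -> root_in (@annotated S) (subterm s p) = ann ->
  flat (subterm s p) = subst sigma (lhs a) ->
  \sum_(x <- rhs a)
     x.1 * (annot_val Pol alpha (contract ann (flag a) s p sigma x.2))%:~R
    <= (annot_val Pol alpha s)%:~R :> R.
Proof.
move=> [pl dl [_ sum1] rl] c1 c2 ps annE fs.
have [beta [A [B [A0 le_s rE]]]] :=
  annot_val_contract (flag a) pl dl ps annE fs.
apply: le_trans (_ : _ <= _%:~R) _; last by rewrite ler_int; exact: le_s.
rewrite big_seq_cond (eq_bigr (fun x => x.1 *
    (if ann then (pol_annot Pol beta x.2)%:~R else 0) +
    A%:~R * (x.1 * (if flag a then (pol Pol beta (flat x.2))%:~R else 0)) +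
    x.1 * B%:~R)); last first.
  move=> x /andP[xa _]; rewrite rE; last exact: rl.
  rewrite !rmorphD /= pol_annotE; case: (ann); case: (flag a);
  rewrite ?rmorphM /=; lra.
rewrite -big_seq_cond !big_split /= -mulr_sumr -mulr_suml sum1 mul1r.
rewrite !rmorphD /= lerD2r; apply: lerD.
  case: (ann) => //; under eq_bigr do rewrite mulr0; by rewrite big1_eq.
case fa: (flag a) c1 => c1.
  by rewrite rmorphM ler_wpM2l ?ler0z ?c1.
under eq_bigr do rewrite mulr0; by rewrite big1_eq mulr0.
Qed.

Lemma contract_annot_val_lt s p sigma a r :
  is_adp a -> vars r `<=` vars (lhs a) ->
  (forall beta : X -> nat,
     pol_annot Pol beta r < pol Pol beta (sharp (lhs a))) ->
  (flag a = true -> forall beta : X -> nat,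
     pol Pol beta (flat r) <= pol Pol beta (lhs a)) ->
  p \in positions s -> root_in (@annotated S) (subterm s p) ->
  flat (subterm s p) = subst sigma (lhs a) ->
  annot_val Pol alpha (contract true (flag a) s p sigma r)
    < annot_val Pol alpha s.
Proof.
move=> [pl dl _ _] rl c3 c3' ps annE fs.
have [beta [A [B [A0 le_s rE]]]] :=
  annot_val_contract (flag a) pl dl ps annE fs.
apply: lt_le_trans le_s; rewrite rE // ltrD2r -pol_annotE.
apply: ltr_leD; first exact: c3.
by case: (flag a) c3' => // /(_ erefl) c; rewrite ler_wpM2l.
Qed.

End Values.
End Steps.

Lemma esum_bigcup_disjoint (R : realType) (I T : choiceType) (K : set I)
    (J : I -> set T) (a : T -> \bar R) :
  (forall i j x, J i x -> J j x -> i = j) ->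
  (forall i x, J i x -> (0 <= a x)%E) ->
  \esum_(x in \bigcup_(i in K) J i) a x =
  \esum_(i in K) \esum_(x in J i) a x.
Proof.
move=> Jinj a0; rewrite esum_esum => [|i x _ /a0 //].
apply: (reindex_esum _ _ snd); split.
- by move=> [i x] [/= Ki Jx]; exists i.
- move=> [i x] [j y] /set_mem[/= _ Jx] /set_mem[/= _ Jy] xy.
  by rewrite -xy in Jy *; rewrite (Jinj i j x).
- by move=> x [i Ki Jx]; exists (i, x).
Qed.

Section Trees.
Context {S : signature} {X : Type} {R : realType}.
Variable T : @ltree S X R.
Implicit Types (u v w x : carrier T).

Fixpoint reach n v x : Prop :=
  if n is m.+1 then exists2 w, edge v w & reach m w x else v = x.

Lemma reach_snoc n v u x : reach n v u -> edge u x -> reach n.+1 v x.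
Proof.
elim: n v => [v /= -> ux|n IH v [w vw wu] ux]; first by exists x.
by exists w => //; apply: IH.
Qed.

Lemma reach_last n v x :
  reach n.+1 v x -> exists2 u, reach n v u & edge u x.
Proof.
elim: n v => [v [w vw /= <-]|n IH v [w vw /IH[u wu ux]]]; first by exists v.
by exists u => //; exists w.
Qed.

Lemma reach_trans m n u v w : reach m u v -> reach n v w -> reach (m + n) u w.
Proof.
by elim: m u => [u -> //|m IH u [x ux xv] vw]; exists x => //; apply: IH.
Qed.

Hypothesis treeT : is_tree T.

Lemma nodes_edge v w : edge v w -> nodes v /\ nodes w.
Proof. by have [+ _ _] := treeT; apply. Qed.

Lemma edge_parent_unique u v x : edge u x -> edge v x -> u = v.
Proof. by have [_ + _] := treeT; apply. Qed.

Lemma reach_inj n v w x : reach n v x -> reach n w x -> v = w.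
Proof.
elim: n v w => [v w /= -> ->//|n IH v w [v' vv' v'x] [w' ww' w'x]].
by apply: edge_parent_unique vv' _; rewrite (IH v' w').
Qed.

Variable r : carrier T.
Hypothesis rootT : is_root r.

Lemma root_reach v : nodes v -> exists n, reach n r v.
Proof.
case: rootT => _ _ /[apply]; elim=> {v} [u v uv|u|u v w _ [m uv] _ [n vw]].
- by exists 1%N; exists v.
- by exists 0%N.
- by exists (m + n)%N; apply: reach_trans uv vw.
Qed.

Lemma reach_root_unique m n v : reach m r v -> reach n r v -> m = n.
Proof.
have noroot k : ~ reach k.+1 r r.
  by move=> /reach_last[u _]; case: rootT => _ /(_ u).
elim: m n v => [|m IH] [|n] v //.
- by move=> /= <- /noroot.
- by move=> + /= rv; rewrite -rv => /noroot.
move=> /reach_last[u ru uv] /reach_last[u' ru' u'v].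
by congr _.+1; apply: IH ru _; rewrite (edge_parent_unique uv u'v).
Qed.

Lemma tree_recursion (A : Type) (a0 : A)
    (f : carrier T -> A -> carrier T -> A) :
  exists g : carrier T -> A,
    g r = a0 /\ forall v w, edge v w -> g w = f v (g v) w.
Proof.
pose parent w := xget w [set v | edge v w].
pose depth w := xget 0%N [set n | reach n r w].
have depthE n w : reach n r w -> depth w = n.
  move=> rw; apply: (reach_root_unique _ rw).
  exact: (@xgetI _ 0%N [set n | reach n r w] n rw).
have parentE v w : edge v w -> parent w = v.
  move=> vw; apply: (edge_parent_unique _ vw).
  exact: (@xgetI _ w [set v | edge v w] v vw).
pose L := fix L n w :=
  if n is m.+1 then f (parent w) (L m (parent w)) w else a0.
exists (fun w => L (depth w) w); split; first by rewrite (depthE 0%N).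
move=> v w vw; have [nv _] := nodes_edge vw.
have [n rv] := root_reach nv.
by rewrite (depthE _ _ rv) (depthE _ _ (reach_snoc rv vw)) /= (parentE _ _ vw).
Qed.

End Trees.

Section ProbTrees.
Context {S : signature} {X : Type} {R : realType}.

Record prob_tree (T : @ltree S X R) : Prop := ProbTree {
  pt_tree :> is_tree T;
  pt_finite : forall v : carrier T, finite_set (edge v);
  pt_gt0 : forall v : carrier T, nodes v -> 0 < prob v;
  pt_children : forall v : carrier T, inner v ->
    \sum_(w <- fset_set (edge v)) prob w = prob v
}.

Variables (T : @ltree S X R) (r : carrier T).
Hypotheses (ptT : prob_tree T) (rootT : is_root r).
Implicit Types (u v w x : carrier T).

Lemma mem_children v w : (w \in fset_set (edge v)) = (w \in edge v).
Proof. by apply: in_fset_set; apply: pt_finite. Qed.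

Lemma mem_childrenP v w : reflect (edge v w) (w \in fset_set (edge v)).
Proof. by rewrite mem_children; apply: (iffP idP); rewrite inE. Qed.

Fixpoint surv n v : R :=
  if n is m.+1 then \sum_(w <- fset_set (edge v)) surv m w else prob v.

Lemma ler_sum_children (f g : carrier T -> R) v :
  (forall w, edge v w -> f w <= g w) ->
  \sum_(w <- fset_set (edge v)) f w <= \sum_(w <- fset_set (edge v)) g w.
Proof.
move=> fg; rewrite big_seq_cond [leRHS]big_seq_cond; apply: ler_sum => w.
by rewrite andbT => /mem_childrenP; apply: fg.
Qed.

Lemma sum_children_ge0 (f : carrier T -> R) v :
  (forall w, edge v w -> 0 <= f w) -> 0 <= \sum_(w <- fset_set (edge v)) f w.
Proof.
move=> f0; rewrite big_seq_cond; apply: sumr_ge0 => w.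
by rewrite andbT => /mem_childrenP; apply: f0.
Qed.

Lemma prob_children_le v : nodes v ->
  \sum_(w <- fset_set (edge v)) prob w <= prob v.
Proof.
move=> nv; have [->|e] := eqVneq (edge v) set0.
  by rewrite fset_set0 big_seq_fset0 ltW // (pt_gt0 ptT).
by rewrite (pt_children ptT) //; split=> //; apply/set0P.
Qed.

Lemma surv_ge0 n v : nodes v -> 0 <= surv n v.
Proof.
elim: n v => [v /(pt_gt0 ptT)/ltW //|n IH v nv] /=.
by apply: sum_children_ge0 => w /(nodes_edge ptT)[_]; apply: IH.
Qed.

Lemma surv_le n v : nodes v -> surv n v <= prob v.
Proof.
elim: n v => [v //|n IH v nv] /=; apply: le_trans (prob_children_le nv).
by apply: ler_sum_children => w /(nodes_edge ptT)[_]; apply: IH.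
Qed.

Lemma surv_nonincreasing n v : nodes v -> surv n.+1 v <= surv n v.
Proof.
elim: n v => [v|n IH v nv]; first exact: prob_children_le.
by apply: ler_sum_children => w /(nodes_edge ptT)[_]; apply: IH.
Qed.

Definition level_leaves n v := [set x | leaves x /\ reach n v x].

Lemma level_leaves_mass n v : nodes v ->
  \esum_(x in level_leaves n v) (prob x)%:E = (surv n v - surv n.+1 v)%:E.
Proof.
elim: n v => [v nv|n IH v nv].
  have [e|e] := eqVneq (edge v) set0.
    rewrite (_ : level_leaves 0 v = [set v]); last first.
      by apply/seteqP; split=> [x [_ <-]|x ->].
    rewrite esum_set1 ?lee_fin ?ltW ?(pt_gt0 ptT) //= e.
    by rewrite fset_set0 big_seq_fset0 subr0.
  rewrite (_ : level_leaves 0 v = set0); last first.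
    by apply/seteqP; split=> x //= [[_ +] vx]; rewrite -vx; apply/eqP.
  rewrite esum_set0 /= (pt_children ptT) ?subrr //; split=> //; exact/set0P.
have -> : level_leaves n.+1 v = \bigcup_(w in edge v) level_leaves n w.
  apply/seteqP; split=> x /= [].
    by move=> lx [w vw wx]; exists w.
  by move=> w vw [lx wx]; split=> //; exists w.
rewrite esum_bigcup_disjoint; last 2 first.
- by move=> i j x [_ ix] [_ jx]; exact: (reach_inj ptT ix jx).
- by move=> w x [[nx _] _]; rewrite lee_fin ltW // (pt_gt0 ptT).
rewrite (eq_esum (b := fun w => (surv n w - surv n.+1 w)%:E)); last first.
  by move=> w /(nodes_edge ptT)[_ nw]; rewrite IH.
rewrite esum_fset; [|exact: pt_finite|]; last first.
  move=> w /set_mem /(nodes_edge ptT)[_ nw].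
  by rewrite lee_fin subr_ge0 surv_nonincreasing.
by rewrite fsbig_finite ?sumEFin ?sumrB //; apply: pt_finite.
Qed.

Hypothesis prob_root : prob r = 1.

Lemma leaf_massE : leaf_mass T =
  limn (fun n => (1 - surv n r)%:E).
Proof.
have nr : nodes r by case: rootT.
have -> : leaf_mass T = \esum_(n in setT) (surv n r - surv n.+1 r)%:E.
  rewrite /leaf_mass
    (_ : @leaves _ _ _ T = \bigcup_(n in setT) level_leaves n r).
    rewrite esum_bigcup_disjoint; last 2 first.
    - by move=> i j x [_ ix] [_ jx]; exact: (reach_root_unique ptT rootT ix jx).
    - by move=> w x [[nx _] _]; rewrite lee_fin ltW // (pt_gt0 ptT).
    by apply: eq_esum => n _; rewrite level_leaves_mass.
  apply/seteqP; split=> x; last by move=> [n _ []].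
  by move=> lx; have [n rx] := root_reach rootT lx.1; exists n.
rewrite -nneseries_esumT => [|n]; last first.
  by rewrite lee_fin subr_ge0 surv_nonincreasing.
congr (limn _); apply/funext => n; rewrite sumEFin; congr EFin.
rewrite -prob_root -[prob r]/(surv 0 r).
elim: n => [|n IH]; first by rewrite big_nil subrr.
by rewrite big_nat_recr //= IH addrA subrK.
Qed.

Lemma leaf_mass1P : leaf_mass T = 1%:E <->
  forall e : R, 0 < e -> exists n, surv n r <= e.
Proof.
have nr : nodes r by case: rootT.
have nd : nondecreasing_seq (fun n => (1 - surv n r)%:E).
  apply/nondecreasing_seqP => n.
  by rewrite lee_fin lerD2l lerN2 surv_nonincreasing.
have cv := ereal_nondecreasing_is_cvgn nd.
rewrite leaf_massE; split=> [lim1 e e0|small].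
  apply/not_existsP => big.
  have : (limn (fun n => (1 - surv n r)%:E) <= (1 - e)%:E)%E.
    apply: lime_le => //; apply: nearW => n.
    by rewrite lee_fin lerD2l lerN2 ltW // ltNge; apply/negP/big.
  by rewrite lim1 lee_fin; lra.
apply/eqP; rewrite eq_le; apply/andP; split.
  apply: lime_le => //; apply: nearW => n.
  by rewrite lee_fin gerDl oppr_le0 surv_ge0.
apply/lee_addgt0Pr => e e0; have [n ne] := small _ e0.
rewrite -leeBlDr // -EFinB; apply: lime_ge => //; exists n => // m /= nm.
by apply: le_trans (nd _ _ nm); rewrite lee_fin lerD2l lerN2.
Qed.

End ProbTrees.

Lemma squash_le_tangent (R : realFieldType) (x y : R) : 0 <= x -> 0 <= y ->
  y / (1 + y) <= (x ^+ 2 + y) / (1 + x) ^+ 2.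
Proof.
move=> x0 y0; rewrite ler_pdivrMr ?ltr_wpDr // mulrAC ler_pdivlMr; last first.
  by rewrite exprn_gt0 // ltr_wpDr.
by have := sqr_ge0 (x - y); nra.
Qed.

Lemma squash_lt_tangent (R : realFieldType) (x y : R) : 0 <= y -> y + 1 <= x ->
  y / (1 + y) + ((1 + x) ^+ 3)^-1 <= (x ^+ 2 + y) / (1 + x) ^+ 2.
Proof.
move=> y0 yx; have y1 : 0 < 1 + y by rewrite ltr_wpDr.
have x1 : 0 < 1 + x by lra.
have -> : y / (1 + y) + ((1 + x) ^+ 3)^-1 =
    (y * (1 + x) + (1 + y) * ((1 + x) ^+ 2)^-1) / ((1 + y) * (1 + x)).
  by field; rewrite !gt_eqF.
have -> : (x ^+ 2 + y) / (1 + x) ^+ 2 =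
    ((x ^+ 2 + y) * (1 + y) / (1 + x)) / ((1 + y) * (1 + x)).
  by field; rewrite !gt_eqF.
rewrite ler_pM2r ?invr_gt0 ?mulr_gt0 //.
have -> : (x ^+ 2 + y) * (1 + y) / (1 + x) =
    y * (1 + x) + (x - y) ^+ 2 / (1 + x).
  by field; rewrite !gt_eqF.
rewrite lerD2l ler_pdivlMr // expr2 invfM mulrA mulfVK ?gt_eqF //.
rewrite ler_pdivrMr //.
have sq : 1 <= (x - y) ^+ 2 by nra.
nra.
Qed.

Lemma sum_eventually_le (R : realFieldType) (I : eqType) (s : seq I)
    (f : nat -> I -> R) :
  (forall i, i \in s -> forall e, 0 < e ->
     exists n0, forall n, (n0 <= n)%N -> f n i <= e) ->
  forall e, 0 < e ->
     exists n0, forall n, (n0 <= n)%N -> \sum_(i <- s) f n i <= e.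
Proof.
elim: s => [_ e e0|i s IH fs e e0].
  by exists 0%N => n _; rewrite big_nil ltW.
have e2 : 0 < e / 2 by rewrite divr_gt0.
have [n1 n1P] := fs i (mem_head _ _) _ e2.
have [|n2 n2P] := IH _ _ e2.
  by move=> j js; apply: fs; rewrite inE js orbT.
exists (maxn n1 n2) => n; rewrite geq_max => /andP[n1n n2n].
rewrite big_cons (splitr e); apply: lerD; [exact: n1P|exact: n2P].
Qed.

Section Recurrence.
Context {S : signature} {X : Type} {R : realType}.
Variable T : @ltree S X R.
Hypothesis ptT : prob_tree T.
Implicit Types (u v w : carrier T) (K : set (carrier T)).

Fixpoint stop_surv K n v : R :=
  if n is m.+1 then
    if `[< K v >] then 0 else \sum_(w <- fset_set (edge v)) stop_surv K m w
  else prob v.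

Lemma stop_surv_ge0 K n v : nodes v -> 0 <= stop_surv K n v.
Proof.
elim: n v => [v /(pt_gt0 ptT)/ltW //|n IH v nv] /=; case: ifP => // _.
by apply: sum_children_ge0 => // w /(nodes_edge ptT)[_]; apply: IH.
Qed.

Lemma stop_surv_nonincreasing K n v :
  nodes v -> stop_surv K n.+1 v <= stop_surv K n v.
Proof.
elim: n v => [v nv|n IH v nv].
  rewrite /=; case: ifP => _; first by rewrite ltW // (pt_gt0 ptT).
  exact: prob_children_le.
rewrite [leLHS]/= [leRHS]/=; case: ifP => // _.
by apply: ler_sum_children => // w /(nodes_edge ptT)[_]; apply: IH.
Qed.

Variables (V : carrier T -> R) (G : set (carrier T)) (delta : R).
Hypothesis V_ge0 : forall v, 0 <= V v.
Hypothesis V_super : forall v, inner v ->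
  \sum_(w <- fset_set (edge v)) prob w * V w <= prob v * V v.
Hypothesis delta_gt0 : 0 < delta.
Hypothesis V_drop : forall v, G v ->
  exists w, [/\ edge v w, delta * prob v <= prob w & V w + 1 <= V v].
Hypothesis stop_null : forall v, nodes v ->
  forall e : R, 0 < e -> exists n, stop_surv G n v <= e.

Lemma V_super_node v : nodes v ->
  \sum_(w <- fset_set (edge v)) prob w * V w <= prob v * V v.
Proof.
move=> nv; have [->|e] := eqVneq (edge v) set0.
  by rewrite fset_set0 big_seq_fset0 mulr_ge0 // ltW // (pt_gt0 ptT).
by apply: V_super; split=> //; apply/set0P.
Qed.

Section Level.
Variable N : R.
Hypothesis N_gt0 : 0 < N.

(* Mass, within n levels, of the first nodes where V reaches the level N. *)
Fixpoint high n v : R :=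
  if n is m.+1 then
    if N <= V v then prob v else \sum_(w <- fset_set (edge v)) high m w
  else 0.

(* Expected number of visits to G, within n levels, before V reaches N. *)
Fixpoint visits n v : R :=
  if n is m.+1 then
    if N <= V v then 0
    else (if `[< G v >] then prob v else 0) +
         \sum_(w <- fset_set (edge v)) visits m w
  else 0.

(* Mass surviving d levels below N and then n levels outside of G. *)
Fixpoint low d n v : R :=
  if d is e.+1 then
    if N <= V v then 0 else \sum_(w <- fset_set (edge v)) low e n w
  else stop_surv G n v.

Lemma high_le n v : nodes v -> N * high n v <= prob v * V v.
Proof.
elim: n v => [v nv|n IH v nv] /=.
  by rewrite mulr0 mulr_ge0 // ltW // (pt_gt0 ptT).
have p0 := pt_gt0 ptT nv.
case: ifP => NV; first by rewrite mulrC ler_wpM2l // ltW.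
rewrite mulr_sumr; apply: le_trans (V_super_node nv).
by apply: ler_sum_children => // w /(nodes_edge ptT)[_]; apply: IH.
Qed.

Let phi (x : R) := x / (1 + x).
Let c := delta / (1 + N) ^+ 3.

Lemma phi_super v : nodes v -> V v < N ->
  c * (if `[< G v >] then prob v else 0) +
  \sum_(w <- fset_set (edge v)) prob w * phi (V w) <= prob v * phi (V v).
Proof.
move=> nv VN; set x := V v; have x0 : 0 <= x := V_ge0 v.
have pv := pt_gt0 ptT nv.
have x1 : 0 < 1 + x by rewrite ltr_wpDr.
have N1 : 0 < 1 + N by rewrite addr_gt0.
pose b w := prob w * ((x ^+ 2 + V w) / (1 + x) ^+ 2).
have b_le w : edge v w -> prob w * phi (V w) <= b w.
  move=> /(nodes_edge ptT)[_ /(pt_gt0 ptT)/ltW pw].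
  by rewrite ler_wpM2l // squash_le_tangent.
have sum_b : \sum_(w <- fset_set (edge v)) b w <= prob v * phi x.
  rewrite (eq_bigr (fun w => prob w * (x ^+ 2 / (1 + x) ^+ 2) +
      prob w * V w / (1 + x) ^+ 2)); last first.
    by move=> w _; rewrite /b; field; rewrite gt_eqF.
  rewrite big_split /= -!mulr_suml.
  have -> : prob v * phi x = prob v * (x ^+ 2 / (1 + x) ^+ 2) +
      prob v * x / (1 + x) ^+ 2 by rewrite /phi; field; rewrite gt_eqF.
  apply: lerD; apply: ler_wpM2r.
  - by rewrite divr_ge0 // exprn_ge0 // ltW.
  - exact: prob_children_le.
  - by rewrite invr_ge0 exprn_ge0 // ltW.
  - exact: V_super_node.
case: ifPn => [/asboolP Gv|_]; last first.
  by rewrite mulr0 add0r; apply: le_trans sum_b; apply: ler_sum_children.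
apply: le_trans sum_b.
have [u [vu pu Vu]] := V_drop Gv.
have ue : u \in fset_set (edge v) by apply/mem_childrenP.
rewrite (big_fsetD1 u) //= [leRHS](big_fsetD1 u) //= addrA; apply: lerD.
  apply: le_trans (_ : prob u * (phi (V u) + ((1 + x) ^+ 3)^-1) <= _).
    rewrite addrC mulrDr lerD2l /c.
    apply: le_trans (_ : (delta * prob v) / (1 + N) ^+ 3 <= _).
      by rewrite mulrAC.
    apply: ler_pM => //.
    - by rewrite mulr_ge0 // ltW.
    - by rewrite invr_ge0 exprn_ge0 // ltW.
    - rewrite lef_pV2 ?posrE ?exprn_gt0 //.
      by apply: lerXn2r; rewrite ?nnegrE ?ltW // ltrD2l.
  apply: ler_wpM2l; last exact: squash_lt_tangent.
  by have [_ /(pt_gt0 ptT)/ltW] := nodes_edge ptT vu.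
rewrite big_seq_cond [leRHS]big_seq_cond; apply: ler_sum => w.
rewrite andbT in_fsetD1 => /andP[_ /(mem_childrenP ptT)]; exact: b_le.
Qed.

Lemma visits_le n v : nodes v -> c * visits n v <= prob v * phi (V v).
Proof.
elim: n v => [v nv|n IH v nv] /=.
  rewrite mulr0 mulr_ge0 ?(ltW (pt_gt0 ptT nv)) //.
  by rewrite divr_ge0 // addr_ge0.
have p0 := pt_gt0 ptT nv.
case: (leP N (V v)) => NV; last first.
  apply: le_trans (phi_super nv NV); rewrite mulrDr lerD2l mulr_sumr.
  by apply: ler_sum_children => // w /(nodes_edge ptT)[_]; apply: IH.
by rewrite mulr0 mulr_ge0 ?(ltW p0) // divr_ge0 // addr_ge0.
Qed.

Lemma high_ge0 n v : nodes v -> 0 <= high n v.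
Proof.
elim: n v => [//|n IH v nv] /=; case: ifP => _.
  by rewrite ltW // (pt_gt0 ptT).
by apply: sum_children_ge0 => // w /(nodes_edge ptT)[_]; apply: IH.
Qed.

Lemma visits_ge0 n v : nodes v -> 0 <= visits n v.
Proof.
elim: n v => [//|n IH v nv] /=; case: ifP => // _; apply: addr_ge0.
  by case: ifP => // _; rewrite ltW // (pt_gt0 ptT).
by apply: sum_children_ge0 => // w /(nodes_edge ptT)[_]; apply: IH.
Qed.

Lemma surv_le_stop n v : nodes v ->
  surv n v <= stop_surv G n v + high n v + visits n v.
Proof.
elim: n v => [v nv|n IH v nv]; first by rewrite /= !addr0.
have p0 := pt_gt0 ptT nv.
have := surv_le ptT n.+1 nv.
have := stop_surv_ge0 G n.+1 nv.
have := high_ge0 n.+1 nv; have := visits_ge0 n.+1 nv => /=.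
have : \sum_(w <- fset_set (edge v)) surv n w <=
    \sum_(w <- fset_set (edge v)) stop_surv G n w +
    \sum_(w <- fset_set (edge v)) high n w +
    \sum_(w <- fset_set (edge v)) visits n w.
  rewrite -!big_split /=.
  by apply: ler_sum_children => // w /(nodes_edge ptT)[_]; apply: IH.
have : 0 <= \sum_(w <- fset_set (edge v)) visits n w.
  apply: sum_children_ge0 => // w /(nodes_edge ptT)[_]; exact: visits_ge0.
by case: ifP => _; case: ifP => _; lra.
Qed.

Lemma surv_le_low d n v : nodes v ->
  surv (d + n) v <=
    low d n v + high (d + n) v + (visits (d + n) v - visits d v).
Proof.
elim: d v => [v nv|d IH v nv].
  by rewrite add0n subr0; apply: surv_le_stop.
rewrite addSn.
have := surv_le ptT (d + n).+1 nv => /=.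
case: ifP => _; first by lra.
have : \sum_(w <- fset_set (edge v)) surv (d + n) w <=
    \sum_(w <- fset_set (edge v)) low d n w +
    \sum_(w <- fset_set (edge v)) high (d + n) w +
    (\sum_(w <- fset_set (edge v)) visits (d + n) w -
     \sum_(w <- fset_set (edge v)) visits d w).
  rewrite -sumrB -!big_split /=.
  by apply: ler_sum_children => // w /(nodes_edge ptT)[_]; apply: IH.
by lra.
Qed.

Lemma low_null d v : nodes v -> forall e : R, 0 < e ->
  exists n0, forall n, (n0 <= n)%N -> low d n v <= e.
Proof.
elim: d v => [v nv e e0|d IH v nv e e0] /=.
  have [n0 n0e] := stop_null nv e0; exists n0 => n /subnK <-.
  elim: (n - n0)%N => // k; apply: le_trans.
  by rewrite addSn; apply: stop_surv_nonincreasing.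
case: (N <= V v); first by exists 0%N => n _; rewrite ltW.
apply: sum_eventually_le e e0 => w.
by move=> /(mem_childrenP ptT) /(nodes_edge ptT)[_]; apply: IH.
Qed.

Lemma visits_tail v : nodes v -> forall e : R, 0 < e ->
  exists d, forall n, visits (d + n) v - visits d v <= e.
Proof.
move=> nv e e0; pose A := range (visits^~ v).
have c0 : 0 < c by rewrite divr_gt0 // exprn_gt0 // ltr_wpDl.
have supA : has_sup A.
  split; first by exists (visits 0 v); exists 0%N.
  exists (prob v * phi (V v) / c) => _ [n _ <-].
  by rewrite ler_pdivlMr // mulrC visits_le.
have [_ [d _ <-] supd] := sup_adherent e0 supA.
exists d => n.
have : visits (d + n) v <= sup A.
  by apply: ub_le_sup; [case: supA|exists (d + n)%N].
by lra.
Qed.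

End Level.

Lemma surv_null v : nodes v -> forall e : R, 0 < e -> exists n, surv n v <= e.
Proof.
move=> nv e e0; have e3 : 0 < e / 3 by rewrite divr_gt0.
pose N := (prob v * V v + 1) / (e / 3).
have pV : 0 <= prob v * V v by rewrite mulr_ge0 // ltW // (pt_gt0 ptT).
have N0 : 0 < N by rewrite divr_gt0 // ltr_wpDl.
have high_e n : high N n v <= e / 3.
  rewrite -(ler_pM2l N0); apply: le_trans (high_le N n nv) _.
  by rewrite /N divfK ?gt_eqF // lerDl.
have [d visits_e] := visits_tail N0 nv e3.
have [n low_e] := low_null N d nv e3.
exists (d + n)%N; apply: le_trans (surv_le_low N d n nv) _.
have := low_e n (leqnn n); have := visits_e n; have := high_e (d + n)%N.
by lra.
Qed.

End Recurrence.

Section StoppedSubtree.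
Context {S : signature} {X : Type} {R : realType}.
Variables (T : @ltree S X R) (K : set (carrier T)) (v0 : carrier T).

Let live (u w : carrier T) : Prop := edge u w /\ ~ K u.
Let live_nodes : set (carrier T) := [set u | clos_refl_trans_n1 _ live v0 u].

Definition stop_subtree : @ltree S X R := @LTree S X R
  (carrier T) live_nodes (fun u => [set w | live u w /\ live_nodes u])
  (fun u => prob u / prob v0) (@label S X R T)
  [set u | [/\ nodesP u, ~ K u & live_nodes u]].

Variable r : carrier T.
Hypotheses (ptT : prob_tree T) (rootT : is_root r) (nodes_v0 : nodes v0).

Lemma live_reach u : live_nodes u -> exists n, reach n v0 u.
Proof.
elim=> [|u' w [u'w _] _ [n v0u]]; first by exists 0%N.
by exists n.+1; apply: reach_snoc u'w.
Qed.

Lemma live_node u : live_nodes u -> nodes u.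
Proof. by case=> // w u' [/(nodes_edge ptT)[]]. Qed.

Lemma stop_edge (u : carrier T) : live_nodes u -> ~ K u ->
  @edge S X R stop_subtree u = edge u.
Proof. by move=> lu Ku; apply/seteqP; split=> w /=; [case=> -[]|]. Qed.

Lemma stop_edge0 (u : carrier T) : K u -> @edge S X R stop_subtree u = set0.
Proof. by move=> Ku; apply/seteqP; split=> w //= -[[]]. Qed.

Lemma prob_v0_gt0 : 0 < prob v0.
Proof. exact: pt_gt0. Qed.

Lemma stop_root : @is_root S X R stop_subtree v0.
Proof.
split; first exact: rtn1_refl.
  move=> u [[uv _] lu]; have [k v0u] := live_reach lu.
  have [n rv0] := root_reach rootT nodes_v0.
  have := reach_root_unique ptT rootT rv0
    (reach_trans rv0 (reach_snoc v0u uv)).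
  by rewrite -[LHS]addn0 => /addnI.
move=> u lu; have : live_nodes u := lu; elim=> [|x w xw lx IH].
  exact: rt_refl.
by apply: rt_trans IH _; apply: rt_step; split.
Qed.

Lemma stop_is_tree : is_tree stop_subtree.
Proof.
split; last by exists v0; apply: stop_root.
  by move=> u w [uw lu]; split; [exact: lu|exact: (@rtn1_trans _ live v0 u w)].
by move=> u v w [[uw _] _] [[vw _] _]; exact: (edge_parent_unique ptT uw vw).
Qed.

Lemma stop_inner (u : carrier T) : @inner S X R stop_subtree u ->
  [/\ live_nodes u, ~ K u & inner u].
Proof.
move=> [lu [w [[uw Ku] _]]]; split=> //; split; first exact: live_node.
by exists w.
Qed.

Lemma stop_prob_tree : prob_tree stop_subtree.
Proof.
split; first exact: stop_is_tree.
- by move=> u; apply: sub_finite_set (pt_finite ptT u) => w [[]].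
- by move=> u /live_node nu; rewrite divr_gt0 ?pt_gt0.
- move=> u /stop_inner[lu Ku iu]; rewrite stop_edge //.
  by rewrite -mulr_suml (pt_children ptT).
Qed.

Lemma stop_survE n (u : carrier T) : live_nodes u ->
  @surv S X R stop_subtree n u = stop_surv K n u / prob v0.
Proof.
elim: n u => [//|n IH u lu]; rewrite [stop_surv _ _ _]/= -[LHS]/(
  \sum_(w <- fset_set (@edge S X R stop_subtree u))
     @surv S X R stop_subtree n w).
case: ifPn => [/asboolP Ku|/asboolP Ku].
  by rewrite (stop_edge0 Ku) fset_set0 big_seq_fset0 mul0r.
rewrite (stop_edge lu Ku) mulr_suml big_seq [RHS]big_seq.
apply: eq_bigr => w /(mem_childrenP ptT) uw; apply: IH.
by apply: (@rtn1_trans _ live v0 u w).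
Qed.

Lemma live_prob_le u : live_nodes u -> prob u <= prob v0.
Proof.
elim=> // x w [xw _] lx; apply: le_trans.
have [nx nw] := nodes_edge ptT xw.
apply: le_trans (prob_children_le ptT nx).
rewrite (big_fsetD1 w) /=; last exact/(mem_childrenP ptT).
rewrite lerDl big_seq; apply: sumr_ge0 => y; rewrite in_fsetD1.
by move=> /andP[_ /(mem_childrenP ptT)/(nodes_edge ptT)[_ /(pt_gt0 ptT)/ltW]].
Qed.

Variable Q : set (adp S X R).
Hypothesis nodesP_inner : @nodesP S X R T `<=` @inner S X R T.
Hypothesis Q_stepP : forall v : carrier T, nodesP v -> ~ K v ->
  step Q true (label v) (children_dist v).
Hypothesis Q_stepR : forall v : carrier T, inner v -> ~ nodesP v ->
  step Q false (label v) (children_dist v).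
Hypothesis infinite_paths : forall u : nat -> carrier T,
    (forall n, edge (u n) (u n.+1)) ->
    forall n, exists2 m, (n <= m)%N & nodesP (u m).

Lemma stop_children_dist (u : carrier T) : live_nodes u -> ~ K u ->
  @children_dist S X R stop_subtree u = children_dist u.
Proof.
move=> lu Ku; rewrite /children_dist stop_edge //=; congr seq_mset.
apply: eq_map => w; congr (_, _).
rewrite invfM invrK mulrACA mulVf ?mulr1 //.
by rewrite gt_eqF // prob_v0_gt0.
Qed.

Lemma stop_chain_tree : chain_tree Q stop_subtree.
Proof.
split; first exact: stop_is_tree.
- by move=> u _; apply: (pt_finite stop_prob_tree).
- move=> u lu; rewrite (pt_gt0 stop_prob_tree) //=.
  by rewrite ler_pdivrMr ?mul1r ?live_prob_le // prob_v0_gt0.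
- move=> v [lv nov _] /=.
  have vv0 : v = v0.
    move: (lv : live_nodes v) nov => [] // x w xw lx nov.
    by case: (nov x).
  by rewrite vv0 divff // gt_eqF // prob_v0_gt0.
- by move=> u [/nodesP_inner[nu [w uw]] Ku lu]; split=> //; exists w; split.
- by move=> u [Pu Ku lu]; rewrite stop_children_dist //; apply: Q_stepP.
- move=> u /stop_inner[lu Ku iu] nPu; rewrite stop_children_dist //.
  by apply: Q_stepR => // Pu; apply: nPu.
- move=> u ue n; have [|m nm Pm] := infinite_paths (u := u) _ n.
    by move=> k; have [[]] := ue k.
  by exists m => //; have [[_ Ku] lu] := ue m.
Qed.

Lemma stop_surv_null : iAST Q ->
  forall e : R, 0 < e -> exists n, stop_surv K n v0 <= e.
Proof.
move=> /(_ _ stop_chain_tree) /leaf_mass1P => /(_ _ stop_prob_tree stop_root).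
have lv0 : live_nodes v0 by exact: rtn1_refl.
move=> /(_ (divff (lt0r_neq0 prob_v0_gt0))).
move=> small e e0; have [|n] := small (e / prob v0).
  by rewrite divr_gt0 // prob_v0_gt0.
rewrite stop_survE // ler_pM2r ?invr_gt0 ?prob_v0_gt0 //.
by exists n.
Qed.

End StoppedSubtree.

Section ChainTrees.
Context {S : signature} {X : Type} {R : realType}.
Implicit Types (P Q : set (adp S X R)) (T : @ltree S X R).

Lemma sum_children_dist T (v : carrier T) (U : choiceType) (d : {mset U})
    (g : U -> R * term S X) (f : R * term S X -> R) :
  children_dist v = mset_map g d ->
  \sum_(w <- fset_set (edge v)) f (prob w / prob v, label w) =
  \sum_(x <- d) f (g x).
Proof.
move=> /perm_mset_map /(perm_big _) dE.
by rewrite -(big_map g xpredT) -dE big_map.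
Qed.

Lemma chain_tree_step P T (v : carrier T) : chain_tree P T -> inner v ->
  exists2 ann : bool, nodesP v -> ann &
    step P ann (label v) (children_dist v).
Proof.
move=> ctT iv; have [Pv|nPv] := pselect (nodesP v).
  by exists true => //; apply: ct_stepP.
by exists false => //; apply: ct_stepR.
Qed.

Lemma chain_tree_prob_tree P T : (forall a, P a -> is_adp a) ->
  chain_tree P T -> prob_tree T.
Proof.
move=> P_adp ctT; split; first exact: ct_tree ctT.
- move=> v; have [nv|nv] := pselect (nodes v); first exact: ct_finite ctT v nv.
  rewrite (_ : edge v = set0) //; apply/seteqP; split=> w // vw.
  by apply: nv; have [] := nodes_edge (ct_tree ctT) vw.
- by move=> v /(ct_prob ctT)/andP[].
move=> v iv.
have [ann _ [a [sigma [p [Pa _ _ _ dE]]]]] := chain_tree_step ctT iv.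
have [_ _ [_ sum1] _] := P_adp _ Pa.
have := sum_children_dist fst dE; rewrite /= sum1 -mulr_suml => pE.
have p0 : 0 < prob v by have /andP[] := ct_prob ctT iv.1.
by rewrite -[LHS](divfK (lt0r_neq0 p0)) pE mul1r.
Qed.

Lemma positive_seq_lower_bound (s : seq R) : (forall x, x \in s -> 0 < x) ->
  exists2 d : R, 0 < d & forall x, x \in s -> d <= x.
Proof.
elim: s => [_|y s IH pos]; first by exists 1.
have [|d d0 dP] := IH; first by move=> x xs; apply: pos; rewrite inE xs orbT.
exists (Num.min y d); first by rewrite lt_min d0 pos ?mem_head.
move=> x; rewrite inE ge_min => /orP[/eqP ->|/dP ->]; rewrite ?lexx ?orbT //.
Qed.

Lemma adp_problem_min_prob P : adp_problem P ->
  exists2 delta : R, 0 < delta &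
    forall a x, P a -> x \in rhs a -> delta <= x.1.
Proof.
move=> [finP P_adp].
have /choice[m mP] (a : adp S X R) : exists d : R, P a ->
    0 < d /\ forall x, x \in rhs a -> d <= x.1.
  have [/P_adp[_ _ [pos _] _]|nPa] := pselect (P a); last by exists 0.
  have [|d d0 dP] := @positive_seq_lower_bound [seq x.1 | x <- rhs a].
    by move=> _ /mapP[x xa ->]; have /andP[] := pos x xa.
  by exists d => _; split=> // x xa; apply: dP; apply: map_f.
have [|d d0 dP] := @positive_seq_lower_bound (fset_set (m @` P)).
  move=> x; rewrite in_fset_set; last exact: finite_image.
  by move=> /set_mem[a /mP[ma _] <-].
exists d => // a x Pa xa; apply: le_trans (_ : m a <= _).
  apply: dP; rewrite in_fset_set; last exact: finite_image.
  by apply/mem_set; exists a.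
by have [_] := mP a Pa; apply.
Qed.

End ChainTrees.

Section Completeness.
Context {S : signature} {X : Type} {R : realType}.
Variables (P Pge Pgt : set (adp S X R)).
Hypotheses (P_adp : forall a, P a -> is_adp a) (PE : P = Pge `|` Pgt).
Local Notation P' := (Pge `|` [set flat_adp a | a in Pgt]).

Lemma chain_tree_more_annot (T : @ltree S X R) : chain_tree P' T ->
  exists (lab : carrier T -> term S X) (nP : set (carrier T)),
    chain_tree P (@LTree S X R (carrier T) (@nodes _ _ _ T) (@edge _ _ _ T)
                    (@prob _ _ _ T) lab nP).
Proof.
move=> ctT; have [_ _ [r rootT]] := ct_tree ctT.
pose good (v : carrier T) t (g : carrier T -> term S X) :=
  (forall w, edge v w -> more_annot (label w) (g w)) /\
  exists2 ann : bool, nodesP v -> ann &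
    step P ann t (seq_mset [seq (prob w / prob v, g w)
                           | w <- fset_set (edge v)]).
have /choice[F FP] (vt : carrier T * term S X) : exists g,
    inner vt.1 -> more_annot (label vt.1) vt.2 -> good vt.1 vt.2 g.
  case: vt => v t /=; have [iv|niv] := pselect (inner v); last first.
    by exists (fun=> t).
  have [mt|nmt] := pselect (more_annot (label v) t); last by exists (fun=> t).
  have [ann annP st] := chain_tree_step ctT iv.
  have [g [gm [ann' annI st']]] :=
    step_more_annot P_adp PE (fset_uniq _) st mt.
  exists g => _ _; split; last by exists ann' => // /annP.
  move=> w vw; apply: gm; rewrite in_fset_set; last exact: ct_finite ctT _ iv.1.
  exact/mem_set.
have [lab [lab_r labE]] := tree_recursion (ct_tree ctT) rootT (label r)
  (fun v t w => F (v, t) w).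
have more_lab v : nodes v -> more_annot (label v) (lab v).
  move=> /(root_reach rootT)[n]; elim: n v => [v <-|n IH v].
    by rewrite lab_r; apply: more_annot_refl.
  move=> /reach_last[u /IH mu uv]; rewrite (labE u) //.
  have [nu _] := nodes_edge (ct_tree ctT) uv.
  by have [||+ _] := FP (u, lab u) => //; [split=> //; exists v|apply].
pose T0 nP := @LTree S X R (carrier T) (@nodes _ _ _ T) (@edge _ _ _ T)
                    (@prob _ _ _ T) lab nP.
have lab_step v : inner v -> exists2 ann : bool, nodesP v -> ann &
    step P ann (lab v) (@children_dist _ _ _ (T0 set0) v).
  move=> iv; have [|_ [ann annP st]] := FP (v, lab v) iv.
    by apply: more_lab; case: iv.
  exists ann => //; rewrite /children_dist /=.
  suff -> : [seq (prob w / prob v, lab w) | w <- fset_set (edge v)] =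
    [seq (prob w / prob v, F (v, lab v) w) | w <- fset_set (edge v)] by [].
  apply/eq_in_map => w; rewrite in_fset_set; last exact: ct_finite ctT _ iv.1.
  by move=> /set_mem vw; rewrite (labE v).
pose nP := [set v : carrier T | inner v /\
  step P true (lab v) (@children_dist _ _ _ (T0 set0) v)].
exists lab, nP; split.
- exact: ct_tree ctT.
- exact: ct_finite ctT.
- exact: ct_prob ctT.
- exact: ct_root ctT.
- by move=> v [].
- by move=> v [].
- move=> v iv nPv; have [[] _ st] := lab_step v iv; last exact: st.
  by case: nPv.
- move=> u ue n; have [m nm Pm] := ct_infinite ctT ue n; exists m => //.
  have im := ct_nodesP ctT Pm; split=> //.
  have [ann annP st] := lab_step _ im.
  by have annE := annP Pm; rewrite annE in st.
Qed.

Lemma flatten_complete : iAST P -> iAST P'.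
Proof.
by move=> astP T /chain_tree_more_annot[lab [nP /astP <-]].
Qed.

End Completeness.

Section Soundness.
Context {S : signature} {X : Type} {R : realType}.
Variables (P Pge Pgt : set (adp S X R)) (Pol : polint S).
Hypotheses (P_prob : adp_problem P) (PE : P = Pge `|` Pgt).
Hypothesis Pol_multilinear : multilinear Pol.
Hypothesis weak_flat : forall a, P a -> flag a = true ->
  forall alpha : X -> nat,
    \sum_(x <- rhs a) x.1 * (pol Pol alpha (flat x.2))%:~R
      <= (pol Pol alpha (lhs a))%:~R :> R.
Hypothesis weak_annot : forall a, P a -> forall alpha : X -> nat,
  \sum_(x <- rhs a) x.1 * (pol_annot Pol alpha x.2)%:~R
    <= (pol Pol alpha (sharp (lhs a)))%:~R :> R.
Hypothesis strict_annot : forall a, Pgt a ->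
  exists x : R * term S X,
    [/\ x \in rhs a,
        forall alpha : X -> nat,
          pol_annot Pol alpha x.2 < pol Pol alpha (sharp (lhs a)) &
        flag a = true -> forall alpha : X -> nat,
          pol Pol alpha (flat x.2) <= pol Pol alpha (lhs a)].
Local Notation P' := (Pge `|` [set flat_adp a | a in Pgt]).

Lemma flatten_sound : iAST P' -> iAST P.
Proof.
have [_ P_adp] := P_prob.
move=> astP' T ctT; have [_ _ [r rootT]] := ct_tree ctT.
have ptT := chain_tree_prob_tree P_adp ctT.
apply/(leaf_mass1P ptT rootT); first exact: ct_root ctT r rootT.
pose V (v : carrier T) : R := (annot_val Pol (fun=> 0%N) (label v))%:~R.
pose G := [set v : carrier T | nodesP v /\ exists a sigma p,
  [/\ Pgt a, p \in positions (label v),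
     root_in (@annotated S) (subterm (label v) p) = true,
     flat (subterm (label v) p) = subst sigma (lhs a) &
     children_dist v = mset_map
       (fun x => (x.1, contract true (flag a) (label v) p sigma x.2)) (rhs a)]].
have [delta delta0 deltaP] := adp_problem_min_prob P_prob.
apply: (surv_null ptT (V := V) (G := G) (delta := delta)) => //.
- by move=> v; rewrite ler0z annot_val_ge0.
- move=> v iv; have [ann _ [a [sigma [p [Pa ps annE [fs _] dE]]]]] :=
    chain_tree_step ctT iv.
  move: ps annE; rewrite !mem_pos_in => /andP[_ ps]; rewrite ps andbT => annE.
  have p0 := pt_gt0 ptT iv.1.
  rewrite -ler_pdivrMl // mulr_sumr.
  rewrite (eq_bigr (fun w => (prob w / prob v) * V w)); last first.
    by move=> w _; rewrite mulrA [_^-1 * _]mulrC.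
  have -> := sum_children_dist
    (fun y => y.1 * (annot_val Pol (fun=> 0%N) y.2)%:~R) dE.
  apply: contract_annot_val_average => //;
    [exact: P_adp|exact: weak_flat|exact: weak_annot].
- move=> v [Pv [a [sigma [p [gt ps annE fs dE]]]]].
  have Pa : P a by rewrite PE; right.
  have [x [xa lt_x le_x]] := strict_annot gt.
  have [_ _ _ /(_ x xa) xl] := P_adp _ Pa.
  have : (x.1, contract true (flag a) (label v) p sigma x.2) \in
      [seq (prob w / prob v, label w) | w <- fset_set (edge v)].
    by rewrite (perm_mem (perm_mset_map dE)); apply/mapP; exists x.
  have p0 := pt_gt0 ptT (ct_nodesP ctT Pv).1.
  move=> /mapP[w /(mem_childrenP ptT) vw [xw lw]]; exists w; split=> //.
    by rewrite -ler_pdivlMr // -xw (deltaP a).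
  rewrite /V -lw -[1]/(1%:~R) -intrD ler_int lezD1.
  exact: (contract_annot_val_lt _ Pol_multilinear (P_adp _ Pa) xl lt_x le_x).
- move=> v nv; apply: stop_surv_null astP' => //.
  + exact: rootT.
  + exact: ct_nodesP ctT.
  + move=> u Pu nGu.
    have [gt|//] := step_ge_flatten P_adp PE (ct_stepP ctT Pu).
    by case: nGu.
  + move=> u iu nPu; apply: (step_unannotated_flatten P_adp PE).
    exact: ct_stepR ctT _ iu nPu.
  + exact: ct_infinite ctT.
- by case: rootT.
Qed.

End Soundness.

Theorem theorem19 (S : signature) (X : Type) (R : realType)
    (P Pge Pgt : set (adp S X R)) (Pol : polint S) :
  adp_problem P ->
  weakly_monotonic Pol ->
  multilinear Pol ->
  P = Pge `|` Pgt ->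
  Pge `&` Pgt = set0 ->
  Pgt !=set0 ->
  (forall a, P a -> flag a = true ->
     forall alpha : X -> nat,
       \sum_(x <- rhs a) x.1 * (pol Pol alpha (flat x.2))%:~R
         <= (pol Pol alpha (lhs a))%:~R :> R) ->
  (forall a, P a ->
     forall alpha : X -> nat,
       \sum_(x <- rhs a) x.1 * (pol_annot Pol alpha x.2)%:~R
         <= (pol Pol alpha (sharp (lhs a)))%:~R :> R) ->
  (forall a, Pgt a ->
     exists x : R * term S X,
       [/\ x \in rhs a,
           forall alpha : X -> nat,
             pol_annot Pol alpha x.2 < pol Pol alpha (sharp (lhs a)) &
           flag a = true ->
             forall alpha : X -> nat,
               pol Pol alpha (flat x.2) <= pol Pol alpha (lhs a)]) ->
  (iAST P <-> iAST (Pge `|` [set flat_adp a | a in Pgt])).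
Proof.
move=> P_prob _ Pol_multilinear PE _ _ weak_flat weak_annot strict_annot.
split; first exact: flatten_complete (proj2 P_prob) PE.
exact: (flatten_sound P_prob PE Pol_multilinear weak_flat weak_annot).
Qed.
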